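(* Let $\lambda\vdash n$ be a partition and let $\mathbf{x}=(x_i)_{i\in\mathbb{Z}}$ be commuting indeterminates. Then, as an identity of rational functions in $\mathbf{x}$, \[\sum_{T}T_{\mathbf{x}}=\prod_{(i,j)\in\lambda}\frac{1}{h_\lambda(i,j;\mathbf{x})},\] where the sum is over all standard Young tableaux $T$ of shape $\lambda$.
   Context: Partitions are drawn in English notation with matrix coordinates: the box in row $i$ and column $j$ is $(i,j)$. The hook $H_\lambda(i,j)$ is the set of boxes $(i,j')\in\lambda$ with $j'\ge j$ together with the boxes $(i',j)\in\lambda$ with $i'\ge i$, and the $\mathbf{x}$-hook-length is $h_\lambda(i,j;\mathbf{x})=\sum_{(i',j')\in H_\lambda(i,j)}x_{j'-i'}$. For a standard Young tableau $T$ of shape $\lambda\vdash n$ and $k\in[n]$, let $(i_T(k),j_T(k))$ be the box containing $k$, and define \[T_{\mathbf{x}}=\prod_{k=1}^{n}\frac{1}{\sum_{l=1}^{k}x_{j_T(n+1-l)-i_T(n+1-l)}}.\] *)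

(* Defs.v *)
From HB Require Import structures.
From mathcomp Require Import all_boot all_order all_algebra.
Set Implicit Arguments. Unset Strict Implicit. Unset Printing Implicit Defensive.
Import Order.TTheory GRing.Theory Num.Theory.

(* Boxes are 0-indexed pairs (row, column) in English/matrix notation.
   Contents j - i are invariant under shifting both coordinates by 1. *)

Definition is_partition (lam : seq nat) : bool :=
  sorted geq lam && all (fun p => 0 < p) lam.

Definition in_diagram (lam : seq nat) (i j : nat) : bool :=
  (i < size lam) && (j < nth 0 lam i).

Definition content (i j : nat) : int := (j%:Z - i%:Z)%R.

Section Hooks.
Variables (n : nat) (lam : seq nat).

(* boxes of lam (with coordinates < n, which is all of them when lam |- n) *)
Definition box_in (b : 'I_n * 'I_n) : bool := in_diagram lam b.1 b.2.

Definition hook (i j : nat) : {set 'I_n * 'I_n} :=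
  [set b : 'I_n * 'I_n | box_in b &&
     (((b.1 == i :> nat) && (j <= b.2)) || ((b.2 == j :> nat) && (i <= b.1)))].

Definition hook_length {R : nmodType} (x : int -> R) (i j : nat) : R :=
  (\sum_(b in hook i j) x (content b.1 b.2))%R.

(* A standard Young tableau T of shape lam |- n, encoded by the map
   f : 'I_n -> boxes, where f k is the box (i_T(k+1), j_T(k+1)) containing
   the entry k+1.  T is a bijection [n] -> lam, increasing along rows
   and down columns. *)
Definition is_syt (f : {ffun 'I_n -> 'I_n * 'I_n}) : bool :=
  [&& injectiveb f,
      [forall k, box_in (f k)],
      [forall b, box_in b ==> [exists k, f k == b]],
      [forall k, forall l,
         ((f l).1 == (f k).1 :> nat) && ((f l).2 == (f k).2.+1 :> nat) ==> (k < l)]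
    & [forall k, forall l,
         ((f l).2 == (f k).2 :> nat) && ((f l).1 == (f k).1.+1 :> nat) ==> (k < l)]].

(* T_x = prod_{k=1}^n 1 / (sum_{l=1}^k x_{c(T(n+1-l))}); with 0-indexed
   entries, T(n+1-l) is f (n-l), and l ranges over 1..k iff the index
   m = n-l satisfies n-k <= m. *)
Definition Tx {F : fieldType} (x : int -> F) (f : {ffun 'I_n -> 'I_n * 'I_n}) : F :=
  (\prod_(k < n)
     (\sum_(m : 'I_n | (n - k.+1 <= m)%N) x (content (f m).1 (f m).2))^-1)%R.

End Hooks.

(* Main.v *)
Require Import Defs.
From mathcomp Require Import all_boot all_order all_algebra.
From mathcomp Require Import perm zify.
Set Implicit Arguments. Unset Strict Implicit. Unset Printing Implicit Defensive.
Import GRing.Theory.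

(* Pad lam with zeros to n rows and attach to each mu inside lam the beta numbers
   beta_i = mu_i + n - 1 - i.  Put a(k) = x_(1-n) + ... + x_(k-n), so that sums of x
   over consecutive contents are differences of values of a.  Let N(mu) be the
   determinant of the factorial powers (z_j | a)^(beta_i(mu)) at z_j = a(beta_j(lam)),
   the numerator of a factorial Schur function.  Since
   z (z|a)^k = (z|a)^(k+1) + a(k) (z|a)^k, we get the Pieri rule
     x(lam/mu) N(mu) = sum of N(mu+) over mu+ obtained from mu by adding a box,
   where N(mu+) vanishes unless mu+ is a partition inside lam.  Iterating it from the
   empty partition, the sum over tableaux times N(lam) equals N(0).  Finally N(lam) is
   triangular and N(0) is a Vandermonde determinant, and their ratio is the product
   of the hook lengths.
   N(0) may vanish for the given x, so the identity is first proved for a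
   deformation of x over the rational functions in one variable 'X, then
   specialized at 'X = 0. *)

Lemma eq_from_leq_sum (I : finType) (f g : I -> nat) :
  (forall i, f i <= g i) -> \sum_i f i = \sum_i g i -> f =1 g.
Proof.
move=> fg sum_eq i.
have [_] := leqif_sum (fun i (_ : xpredT i) => leqif_eq (fg i)).
by rewrite sum_eq eqxx => /esym/forallP/(_ i)/eqP.
Qed.

Lemma sum_tuple_rcons (V : nmodType) (T : finType) m (P : pred (m.+1.-tuple T))
    (G : m.+1.-tuple T -> V) :
  (\sum_(w | P w) G w =
   \sum_(w : m.-tuple T)
     \sum_(j | P [tuple of rcons w j]) G [tuple of rcons w j])%R.
Proof.
rewrite pair_big_dep.
rewrite (reindex (fun p : m.-tuple T * T => [tuple of rcons p.1 p.2])) //=.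
apply/onW_bij/inj_card_bij; last by rewrite card_prod !card_tuple expnSr.
by move=> [v i] [w j] [/rcons_inj[/val_inj-> ->]].
Qed.

Section Determinants.
Local Open Scope ring_scope.
Variables (R : comNzRingType) (n : nat).
Implicit Types A : 'M[R]_n.

Lemma det_row_col_perm (s : 'S_n) A : \det (row_perm s (col_perm s A)) = \det A.
Proof.
rewrite row_permE col_permE !det_mulmx !det_perm odd_permV mulrCA -expr2.
by rewrite sqrr_sign mulr1.
Qed.

Lemma det_zero_block (I J : {set 'I_n}) A : (n < #|I| + #|J|)%N ->
  (forall i j, i \in I -> j \in J -> A i j = 0) -> \det A = 0.
Proof.
move=> ltIJ A0; rewrite /determinant big1 // => s _.
have /exists_inP[i Ii Jsi] : [exists i in I, s i \in J].
  apply: contraLR ltIJ; rewrite negb_exists_in => /forall_inP sIJ.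
  rewrite -leqNgt -(card_imset I (@perm_inj _ s)) -[leqRHS](card_ord n) -(cardsC J).
  rewrite addnC leq_add2l; apply/subset_leq_card/subsetP => _ /imsetP[i Ii ->].
  by rewrite inE sIJ.
by rewrite (bigD1 i) //= A0 // mul0r mulr0.
Qed.

Lemma det_monic_horner (q : nat -> {poly R}) (z : 'I_n -> R) :
  (forall k, q k \is monic) -> (forall k, size (q k) = k.+1) ->
  \det (\matrix_(i < n, j < n) (q i).[z j]) =
  \prod_(i < n) \prod_(j < n | (i < j)%N) (z j - z i).
Proof.
move=> monic_q size_q.
pose coefs := \matrix_(i < n, j < n) (q i)`_j.
have -> : \matrix_(i, j) (q i).[z j] = coefs *m Vandermonde n (\row_j z j).
  apply/matrixP => i j; rewrite !mxE (@horner_coef_wide _ n) ?size_q //.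
  by apply: eq_bigr => k _; rewrite !mxE.
rewrite det_mulmx det_trig; last first.
  by apply/is_trig_mxP => i j ij; rewrite mxE nth_default // size_q.
rewrite big1 ?mul1r => [|i _]; last first.
  by rewrite mxE -(monicP (monic_q i)) lead_coefE size_q.
rewrite det_Vandermonde.
by apply: eq_bigr => i _; apply: eq_bigr => j _; rewrite !mxE.
Qed.

End Determinants.

Section Shapes.
Variable n : nat.
Implicit Types mu lam : {ffun 'I_n -> nat}.

Definition beta mu (i : 'I_n) : nat := mu i + (n - i.+1).

Definition add_box mu (j : 'I_n) : {ffun 'I_n -> nat} :=
  [ffun i => mu i + (i == j)].

Definition nonincreasing mu : bool :=
  [forall i : 'I_n, forall j : 'I_n, (j == i.+1 :> nat) ==> (mu j <= mu i)].

Definition subpartition lam mu : bool :=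
  nonincreasing mu && [forall i, mu i <= lam i].

Lemma nonincreasingPn mu :
  reflect (exists i j : 'I_n, j = i.+1 :> nat /\ mu i < mu j) (~~ nonincreasing mu).
Proof.
apply: (iffP forallPn) => -[i].
  case/forallPn=> j; rewrite negb_imply -ltnNge => /andP[/eqP ij mu_ij].
  by exists i, j.
case=> j [ij mu_ij]; exists i.
by apply/forallPn; exists j; rewrite ij eqxx -ltnNge.
Qed.

Lemma nonincreasing_leq mu (i j : 'I_n) :
  nonincreasing mu -> i <= j -> mu j <= mu i.
Proof.
move=> /forallP mu_noninc; case: j => j; elim: j => [|j IHj] jn /=.
  by rewrite leqn0 => /eqP i0; rewrite (_ : Ordinal jn = i) //; apply: val_inj.
rewrite leq_eqVlt => /predU1P[ij|ij].
  by rewrite (_ : Ordinal jn = i) //; apply: val_inj.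
apply: leq_trans (IHj (ltnW jn) ij).
by have /forallP/(_ (Ordinal jn))/implyP := mu_noninc (Ordinal (ltnW jn)); apply.
Qed.

Lemma subpartition_leq lam mu i : subpartition lam mu -> mu i <= lam i.
Proof. by case/andP=> _ /forallP. Qed.

Lemma ltn_beta mu (i j : 'I_n) : nonincreasing mu -> i < j -> beta mu j < beta mu i.
Proof.
move=> mu_noninc ij; have := nonincreasing_leq mu_noninc (ltnW ij).
by rewrite /beta; have := ltn_ord j; lia.
Qed.

Lemma beta_add_box mu i j : beta (add_box mu j) i = beta mu i + (i == j).
Proof. by rewrite /beta ffunE addnAC. Qed.

End Shapes.

Section Bialternants.
Local Open Scope ring_scope.
Variables (K : comNzRingType) (n : nat) (a : nat -> K).
Implicit Types (mu lam : {ffun 'I_n -> nat}) (z : 'I_n -> K).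

Definition fact_pow (k : nat) (y : K) : K := \prod_(t < k) (y - a t).

Definition bialternant z mu : K :=
  \det (\matrix_(i, j) fact_pow (beta mu i) (z j)).

Definition beta_values lam (j : 'I_n) : K := a (beta lam j).

Lemma fact_powS k y : fact_pow k.+1 y = fact_pow k y * (y - a k).
Proof. exact: big_ord_recr. Qed.

Lemma fact_pow_root k t : (t < k)%N -> fact_pow k (a t) = 0.
Proof. by move=> tk; rewrite /fact_pow (bigD1 (Ordinal tk)) //= subrr mul0r. Qed.

Lemma bialternant_pieri z mu :
  \sum_(j < n) bialternant z (add_box mu j) =
  (\sum_(i < n) (z i - a (beta mu i))) * bialternant z mu.
Proof.
rewrite /bialternant /determinant exchange_big mulr_sumr /=.
apply: eq_bigr => s _; rewrite -mulr_sumr mulrCA; congr (_ * _).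
rewrite sumrB [X in (X - _) * _](reindex_inj (@perm_inj _ s)) -sumrB mulr_suml.
apply: eq_bigr => i _; rewrite (bigD1 i) //= [in RHS](bigD1 i) //= mulrA.
congr (_ * _); first by rewrite !mxE beta_add_box eqxx addn1 fact_powS mulrC.
by apply: eq_bigr => k /negPf ki; rewrite !mxE beta_add_box ki addn0.
Qed.

Lemma bialternant_alternate z mu (i j : 'I_n) :
  i != j -> beta mu i = beta mu j -> bialternant z mu = 0.
Proof.
move=> ij beta_ij; rewrite /bialternant (determinant_alternate ij) // => k.
by rewrite !mxE beta_ij.
Qed.

Lemma bialternant_not_sub lam mu i :
  nonincreasing lam -> nonincreasing mu -> (lam i < mu i)%N ->
  bialternant (beta_values lam) mu = 0.
Proof.
move=> lam_noninc mu_noninc lam_mu.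
apply: (@det_zero_block _ _ [set k : 'I_n | k <= i]%N [set k : 'I_n | i <= k]%N).
  rewrite -cardsUI -ltn_subLR; last by rewrite -[leqRHS]card_ord max_card.
  have -> : [set k : 'I_n | k <= i]%N :|: [set k : 'I_n | i <= k]%N = setT.
    by apply/setP => k; rewrite !inE leq_total.
  by rewrite cardsT card_ord subnn; apply/card_gt0P; exists i; rewrite !inE leqnn.
move=> k l; rewrite !inE => ki il; rewrite mxE fact_pow_root // /beta.
have := nonincreasing_leq mu_noninc ki; have := nonincreasing_leq lam_noninc il.
by have := ltn_ord l; have := ltn_ord i; lia.
Qed.

Lemma bialternant_add_box_eq0 lam mu j : nonincreasing lam -> subpartition lam mu ->
  ~~ subpartition lam (add_box mu j) ->
  bialternant (beta_values lam) (add_box mu j) = 0.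
Proof.
move=> lam_noninc /andP[mu_noninc _].
have [add_noninc|/nonincreasingPn[i [k [ki lt_ik]]] _] :=
  boolP (nonincreasing (add_box mu j)).
  rewrite /subpartition add_noninc => /forallPn[i]; rewrite -ltnNge.
  exact: bialternant_not_sub.
have i_neq_k : i != k by rewrite -val_eqE /= ki; lia.
have mu_ki : (mu k <= mu i)%N by apply: nonincreasing_leq; rewrite // ki.
apply: (bialternant_alternate _ i_neq_k); rewrite !beta_add_box /beta.
by move: lt_ik (ltn_ord k); rewrite !ffunE; case: (i == j); case: (k == j); lia.
Qed.

Lemma bialternant_diag lam : nonincreasing lam ->
  bialternant (beta_values lam) lam =
  \prod_(i < n) fact_pow (beta lam i) (a (beta lam i)).
Proof.
move=> lam_noninc; rewrite /bialternant det_trig.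
  by apply: eq_bigr => i _; rewrite mxE.
by apply/is_trig_mxP => i j ij; rewrite mxE fact_pow_root // ltn_beta.
Qed.

Lemma bialternant0 z :
  bialternant z [ffun=> 0%N] = \prod_(i < n) \prod_(j < n | (i < j)%N) (z i - z j).
Proof.
pose q k : {poly K} := \prod_(t <- iota 0 k) ('X - (a t)%:P).
have horner_q k y : (q k).[y] = fact_pow k y.
  rewrite /fact_pow -(big_mkord xpredT (fun t => y - a t)) /index_iota subn0.
  by rewrite horner_prod; apply: eq_bigr => t _; rewrite hornerXsubC.
pose rev : 'S_n := perm (can_inj (@rev_ordK n)).
rewrite /bialternant -(det_row_col_perm rev).
have -> : row_perm rev (col_perm rev
    (\matrix_(i, j) fact_pow (beta [ffun=> 0%N] i) (z j))) =
    \matrix_(i < n, j < n) (q i).[z (rev_ord j)].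
  apply/matrixP => i j; rewrite !mxE !permE horner_q /beta ffunE add0n.
  by congr fact_pow; have /= := congr1 val (rev_ordK i).
rewrite (det_monic_horner (q := q)) => [|k|k]; last 2 first.
- exact: monic_prod_XsubC.
- by rewrite size_prod_XsubC size_iota.
rewrite (exchange_big_dep predT) //= (reindex_inj rev_ord_inj).
apply: eq_bigr => i _; rewrite (reindex_inj rev_ord_inj) /=.
apply: eq_big => [j|j _]; last by rewrite !rev_ordK.
by rewrite ltn_sub2lE.
Qed.

End Bialternants.

Section LatticeWords.
Local Open Scope ring_scope.
Variables (n : nat) (lam : {ffun 'I_n -> nat}).
Implicit Types (mu : {ffun 'I_n -> nat}) (w : seq 'I_n).

Definition shape w : {ffun 'I_n -> nat} := [ffun i => count_mem i w].

Definition lattice_word w : bool :=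
  all (fun k => subpartition lam (shape (take k w))) (iota 0 (size w).+1).

Definition skew_weight (V : zmodType) (a : nat -> V) mu : V :=
  \sum_i (a (beta lam i) - a (beta mu i)).

Lemma shape_nil : shape [::] = [ffun=> 0%N].
Proof. by apply/ffunP => i; rewrite !ffunE. Qed.

Lemma shape_rcons w j : shape (rcons w j) = add_box (shape w) j.
Proof. by apply/ffunP => i; rewrite !ffunE -cats1 count_cat /= addn0 eq_sym. Qed.

Lemma sum_shape w : (\sum_i shape w i = size w)%N.
Proof.
under eq_bigr do rewrite ffunE -sum1_count.
rewrite (exchange_big_dep xpredT) //= -sum1_size; apply: eq_bigr => j _.
by rewrite (big_pred1 j) // => i; rewrite eq_sym.
Qed.

Lemma lattice_wordP w :
  reflect (forall k, (k <= size w)%N -> subpartition lam (shape (take k w)))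
          (lattice_word w).
Proof. by apply: (iffP allP) => sub k kw; apply: sub; rewrite mem_iota in kw *. Qed.

Lemma lattice_word_nil : lattice_word [::].
Proof.
rewrite /lattice_word /= andbT; apply/andP; split; apply/forallP => i.
  by apply/forallP => j; rewrite !ffunE implybT.
by rewrite ffunE.
Qed.

Lemma lattice_word_sub w : lattice_word w -> subpartition lam (shape w).
Proof. by move=> /lattice_wordP/(_ _ (leqnn _)); rewrite take_size. Qed.

Lemma lattice_word_rcons w j :
  lattice_word (rcons w j) = lattice_word w && subpartition lam (add_box (shape w) j).
Proof.
rewrite /lattice_word size_rcons -[_.+2]addn1 iotaD all_cat; congr (_ && _).
  apply: eq_in_all => k; rewrite mem_iota add0n ltnS => /= kw.
  by rewrite -cats1 takel_cat.
by rewrite /= andbT add0n take_oversize ?size_rcons // shape_rcons.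
Qed.

Lemma lattice_word_shape w :
  size w = (\sum_i lam i)%N -> lattice_word w -> shape w = lam.
Proof.
move=> size_w w_lattice; apply/ffunP/eq_from_leq_sum => [i|].
  exact/subpartition_leq/lattice_word_sub.
by rewrite sum_shape.
Qed.

Variables (K : fieldType) (a : nat -> K).
Local Notation numer := (bialternant a (beta_values a lam)).

Definition word_weight w : K :=
  \prod_(k < size w) (skew_weight a (shape (take k w)))^-1.

Lemma word_weight_rcons w j :
  word_weight (rcons w j) = word_weight w * (skew_weight a (shape w))^-1.
Proof.
rewrite /word_weight size_rcons big_ord_recr /= -cats1 take_size_cat //.
by congr (_ * _); apply: eq_bigr => k _; rewrite takel_cat // ltnW.
Qed.

Hypothesis lam_noninc : nonincreasing lam.
Hypothesis skew_weight_neq0 : forall mu,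
  subpartition lam mu -> mu != lam -> skew_weight a mu != 0.

Lemma bialternant_pieri_subpartition mu : subpartition lam mu ->
  \sum_(j < n | subpartition lam (add_box mu j)) numer (add_box mu j) =
  skew_weight a mu * numer mu.
Proof.
move=> mu_sub; rewrite -bialternant_pieri big_rmcond // => j.
exact: bialternant_add_box_eq0.
Qed.

Lemma sum_word_weight_bialternant m : (m <= \sum_i lam i)%N ->
  \sum_(w : m.-tuple 'I_n | lattice_word w) word_weight w * numer (shape w) =
  numer [ffun=> 0%N].
Proof.
elim: m => [|m IHm] m_lam.
  rewrite (big_pred1 [tuple]) => [|w].
    by rewrite /word_weight big_ord0 mul1r shape_nil.
  by rewrite (tuple0 w) [LHS]lattice_word_nil [RHS]eqxx.
rewrite -(IHm (ltnW m_lam)) sum_tuple_rcons [RHS]big_mkcond /=.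
apply: eq_bigr => w _; under eq_bigl do rewrite lattice_word_rcons.
have [w_lattice|_] := ifP; last by rewrite big_pred0.
have w_sub := lattice_word_sub w_lattice.
have w_neq_lam : shape w != lam.
  by apply: contraTneq m_lam => <-; rewrite sum_shape size_tuple ltnn.
under eq_bigr do rewrite word_weight_rcons shape_rcons.
rewrite -mulr_sumr bialternant_pieri_subpartition // -mulrA mulKf //.
exact: skew_weight_neq0.
Qed.

Lemma sum_word_weight m : m = (\sum_i lam i)%N ->
  (\sum_(w : m.-tuple 'I_n | lattice_word w) word_weight w) * numer lam =
  numer [ffun=> 0%N].
Proof.
move=> m_lam; rewrite -(@sum_word_weight_bialternant m) ?m_lam // mulr_suml.
by apply: eq_bigr => w /lattice_word_shape->; rewrite // size_tuple.
Qed.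

End LatticeWords.

Section ContentSums.
Local Open Scope ring_scope.
Variables (V : zmodType) (n : nat) (x : int -> V).

(* The contents occurring in n rows start at 1 - n. *)
Definition content_sum (k : nat) : V := \sum_(t < k) x (content n t.+1).

Lemma content_sumS i c : (i < n)%N ->
  x (content i c) = content_sum (c + (n - i.+1)).+1 - content_sum (c + (n - i.+1)).
Proof.
move=> i_n; rewrite /content_sum big_ord_recr /= addrAC subrr add0r.
by congr x; rewrite /content; lia.
Qed.

Lemma sum_row_contents i p q : (i < n)%N -> (p <= q)%N ->
  \sum_(p <= c < q) x (content i c) =
  content_sum (q + (n - i.+1)) - content_sum (p + (n - i.+1)).
Proof.
move=> i_n pq.
apply: (telescope_sumr_eq (fun c => content_sum (c + (n - i.+1)))) => // c _.
exact: content_sumS.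
Qed.

Lemma sum_column_contents c p q : (p <= q)%N -> (q <= n)%N ->
  \sum_(p <= i < q) x (content i c) =
  content_sum (c + (n - p)) - content_sum (c + (n - q)).
Proof.
move=> pq qn.
rewrite (telescope_sumr_eq (fun i => - content_sum (c + (n - i)))) //.
  by rewrite opprK addrC.
move=> i /andP[_ iq].
have i_n := leq_trans iq qn; rewrite (content_sumS c i_n) opprK addrC -addnS.
by rewrite subnSK.
Qed.

End ContentSums.

Lemma raddf_content_sum (U V : zmodType) (g : {additive U -> V}) n (x : int -> U) k :
  content_sum n (g \o x) k = g (content_sum n x k).
Proof. by rewrite /content_sum raddf_sum. Qed.

Lemma nth_partition_leq lam i j :
  is_partition lam -> i <= j -> nth 0 lam j <= nth 0 lam i.
Proof.
move=> /andP[lam_sorted _] ij; have [j_lt|j_ge] := ltnP j (size lam); last first.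
  by rewrite nth_default.
have geq_trans : transitive geq by move=> p q r /= pq /leq_trans; apply.
apply: (sorted_leq_nth geq_trans leqnn 0 lam_sorted) => //; rewrite inE //.
exact: leq_ltn_trans j_lt.
Qed.

Lemma size_partition lam : is_partition lam -> size lam <= sumn lam.
Proof.
case/andP=> _ /allP lam_gt0; rewrite sumnE -sum1_size !big_seq.
exact: leq_sum.
Qed.

Definition row_lengths n (lam : seq nat) : {ffun 'I_n -> nat} :=
  [ffun i : 'I_n => nth 0 lam i].

Definition column_length (lam : seq nat) (c : nat) : nat := find (geq c) lam.

Section Partitions.
Variables (n : nat) (lam : seq nat).
Hypotheses (lam_part : is_partition lam) (lam_size : sumn lam = n).
Local Notation rows := (row_lengths n lam).

Lemma row_lengths_nonincreasing : nonincreasing rows.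
Proof.
apply/forallP => i; apply/forallP => j; apply/implyP => /eqP ij.
by rewrite !ffunE ij nth_partition_leq.
Qed.

Lemma sum_row_lengths : \sum_i rows i = n.
Proof.
under eq_bigr do rewrite ffunE.
have lam_n : size lam <= n by rewrite -lam_size size_partition.
rewrite -[RHS]lam_size sumnE (big_nth 0) big_mkord.
rewrite (big_ord_widen n (fun i => nth 0 lam i) lam_n) [RHS]big_rmcond // => i.
by rewrite -leqNgt => /(nth_default 0).
Qed.

Lemma row_length_leq i : rows i <= n.
Proof. by rewrite -[leqRHS]sum_row_lengths (bigD1 i) //= leq_addr. Qed.

Lemma box_inE (b : 'I_n * 'I_n) : box_in lam b = (b.2 < rows b.1).
Proof.
rewrite /box_in /in_diagram ffunE; case: ltnP => //= lam_b.
by rewrite nth_default.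
Qed.

Lemma ltn_column_length c i : (i < column_length lam c) = (c < nth 0 lam i).
Proof.
apply/idP/idP => [/(before_find 0)/negbT|]; first by rewrite /= -ltnNge.
apply: contraTT; rewrite -!leqNgt => /(nth_partition_leq lam_part)/leq_trans; apply.
have [has_c|] := boolP (has (geq c) lam); first exact: (nth_find 0 has_c).
by rewrite has_find -leqNgt => /(nth_default 0)->.
Qed.

Lemma column_length_leq c : column_length lam c <= n.
Proof. by rewrite (leq_trans (find_size _ _)) // -lam_size size_partition. Qed.

Lemma column_length_homo : {homo column_length lam : c d /~ c <= d}.
Proof.
move=> d c cd; case def_i: (column_length lam d) => [//|i].
by rewrite ltn_column_length (leq_ltn_trans cd) // -ltn_column_length def_i.
Qed.

End Partitions.

Lemma is_sytP n lam (f : {ffun 'I_n -> 'I_n * 'I_n}) :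
  reflect [/\ injective f, forall k, box_in lam (f k),
    forall b, box_in lam b -> exists k, f k = b,
    forall k l, (f l).1 = (f k).1 :> nat -> (f l).2 = (f k).2.+1 :> nat -> k < l
    & forall k l, (f l).2 = (f k).2 :> nat -> (f l).1 = (f k).1.+1 :> nat -> k < l]
    (is_syt lam f).
Proof.
apply: (iffP and5P).
  case=> /injectiveP f_inj /forallP f_in /forallP f_onto /forallP rows_inc.
  move=> /forallP cols_inc; split=> // [b b_in|k l eq_row eq_col|k l eq_col eq_row].
  - by have /existsP[k /eqP] := implyP (f_onto b) b_in; exists k.
  - by have /forallP/(_ l) := rows_inc k; rewrite eq_row eq_col !eqxx.
  by have /forallP/(_ l) := cols_inc k; rewrite eq_row eq_col !eqxx.
case=> f_inj f_in f_onto rows_inc cols_inc; split.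
- exact/injectiveP.
- exact/forallP.
- apply/forallP => b; apply/implyP => /f_onto[k <-].
  by apply/existsP; exists k.
- apply/forallP => k; apply/forallP => l.
  by apply/implyP => /andP[/eqP eq_row /eqP eq_col]; apply: rows_inc.
apply/forallP => k; apply/forallP => l.
by apply/implyP => /andP[/eqP eq_col /eqP eq_row]; apply: cols_inc.
Qed.

Section WordTableaux.
Variable n : nat.
Implicit Types (w : n.-tuple 'I_n) (f : {ffun 'I_n -> 'I_n * 'I_n}).

Lemma count_take_ltn_size w (k : 'I_n) : count_mem (tnth w k) (take k w) < n.
Proof.
by apply: leq_ltn_trans (count_size _ _) _; rewrite size_take size_tuple ltn_ord.
Qed.

(* The letter of [w] at [k] is the row of the entry [k]; each row is filled from left
   to right. *)
Definition syt_of_word w : {ffun 'I_n -> 'I_n * 'I_n} :=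
  [ffun k => (tnth w k, Ordinal (count_take_ltn_size w k))].

Definition word_of_syt f : n.-tuple 'I_n := [tuple (f k).1 | k < n].

Lemma syt_of_word1 w k : (syt_of_word w k).1 = tnth w k.
Proof. by rewrite ffunE. Qed.

Lemma shape_syt_of_word w (k : 'I_n) :
  shape (take k w) (syt_of_word w k).1 = (syt_of_word w k).2.
Proof. by rewrite !ffunE. Qed.

Lemma syt_of_wordK : cancel syt_of_word word_of_syt.
Proof. by move=> w; apply: eq_from_tnth => k; rewrite tnth_mktuple ffunE. Qed.

Lemma shape_takeS w (k : 'I_n) :
  shape (take k.+1 w) = add_box (shape (take k w)) (tnth w k).
Proof.
by rewrite (take_nth (tnth w k)) ?size_tuple // -tnth_nth shape_rcons.
Qed.

Lemma shape_take_leq w i k l : k <= l -> shape (take k w) i <= shape (take l w) i.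
Proof. by move=> kl; rewrite !ffunE -(subnKC kl) takeD count_cat leq_addr. Qed.

(* The entries before [k] fill exactly the boxes of [shape (take k w)]. *)
Lemma ltn_syt_of_word w (l : 'I_n) k :
  ((syt_of_word w l).2 < shape (take k w) (syt_of_word w l).1) = (l < k).
Proof.
rewrite -shape_syt_of_word syt_of_word1.
have [lk|kl] := ltnP l k; last by rewrite ltnNge shape_take_leq.
have := shape_take_leq w (tnth w l) lk.
by rewrite shape_takeS [add_box _ _ _]ffunE eqxx addn1.
Qed.

Lemma syt_of_word_onto w k (b : 'I_n * 'I_n) :
  k <= n -> b.2 < shape (take k w) b.1 -> exists2 l : 'I_n, l < k & syt_of_word w l = b.
Proof.
elim: k => [|k IHk] kn; first by rewrite take0 ffunE.
rewrite (shape_takeS w (Ordinal kn)) ffunE /=.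
have [/(IHk (ltnW kn))[l lk <-] _|shape_b] := ltnP b.2 (shape (take k w) b.1).
  by exists l; first exact: ltnW.
have [b1|_] := eqVneq b.1 (tnth w (Ordinal kn)); last by rewrite addn0 ltnNge shape_b.
rewrite addn1 ltnS => b_shape; exists (Ordinal kn) => //.
rewrite [LHS]surjective_pairing [RHS]surjective_pairing syt_of_word1 b1.
congr pair; apply/val_inj/eqP; rewrite /= -shape_syt_of_word syt_of_word1 -b1.
by rewrite eqn_leq shape_b.
Qed.

Variable lam : seq nat.
Hypotheses (lam_part : is_partition lam) (lam_size : sumn lam = n).
Local Notation rows := (row_lengths n lam).

Lemma word_of_sytK f : is_syt lam f -> syt_of_word (word_of_syt f) = f.
Proof.
case/is_sytP=> f_inj f_in f_onto rows_inc _; set w := word_of_syt f.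
have w_row k : tnth w k = (f k).1 by rewrite tnth_mktuple.
apply/ffunP => k; have [m] := ubnP (k : nat); elim: m k => // m IHm k km.
have before_k (l : 'I_n) : l < k -> syt_of_word w l = f l.
  by move=> lk; apply: IHm; apply: leq_trans lk km.
rewrite [LHS]surjective_pairing [RHS]surjective_pairing syt_of_word1 w_row.
congr pair; apply/val_inj/eqP; rewrite /= -shape_syt_of_word syt_of_word1 w_row.
rewrite eqn_leq; apply/andP; split; rewrite leqNgt; apply/negP.
  case/(syt_of_word_onto (ltnW (ltn_ord k))) => l lk.
  by rewrite before_k // => /f_inj eq_lk; rewrite eq_lk ltnn in lk.
case def_c: (val (f k).2) => [//|c]; rewrite ltnS => shape_c.
have c_n : c < n by have := ltn_ord (f k).2; rewrite /= in def_c; lia.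
have [|l f_l] := f_onto ((f k).1, Ordinal c_n).
  by have := f_in k; rewrite !box_inE /= -def_c; apply: ltnW.
have lk : l < k by apply: rows_inc; rewrite f_l.
by have := ltn_syt_of_word w l k; rewrite before_k // f_l lk ltnNge shape_c.
Qed.

Lemma lattice_word_of_syt w : is_syt lam (syt_of_word w) -> lattice_word rows w.
Proof.
case/is_sytP=> _ f_in f_onto _ cols_inc.
apply/lattice_wordP => k; rewrite size_tuple => kn.
have sub_rows i : shape (take k w) i <= rows i.
  rewrite leqNgt; apply/negP => gt_rows.
  have rows_n : rows i < n.
    apply: leq_trans gt_rows _; rewrite ffunE (leq_trans (count_size _ _)) //.
    by rewrite size_take_min geq_min kn.
  have [l _ f_l] := @syt_of_word_onto w k (i, Ordinal rows_n) kn gt_rows.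
  by have := f_in l; rewrite f_l box_inE ltnn.
apply/andP; split; last exact/forallP.
apply/negPn/negP => /nonincreasingPn[i [j [ji lt_ij]]].
have c_n : shape (take k w) i < n.
  exact: leq_trans lt_ij (leq_trans (sub_rows j) (row_length_leq lam_part lam_size j)).
have [l lk f_l] := @syt_of_word_onto w k (j, Ordinal c_n) kn lt_ij.
have [|m f_m] := f_onto (i, Ordinal c_n).
  rewrite box_inE /= (leq_trans lt_ij) // (leq_trans (sub_rows j)) //.
  by rewrite (nonincreasing_leq (row_lengths_nonincreasing _ lam_part)) // ji.
have ml : m < l by apply: cols_inc; rewrite f_l f_m.
by have := ltn_syt_of_word w m k; rewrite f_m ltnn (ltn_trans ml lk).
Qed.

Lemma shape_lattice_word w : lattice_word rows w -> shape w = rows.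
Proof. by apply: lattice_word_shape; rewrite size_tuple sum_row_lengths. Qed.

Lemma is_syt_of_lattice_word w : lattice_word rows w -> is_syt lam (syt_of_word w).
Proof.
move=> w_lattice; have /lattice_wordP prefix_sub := w_lattice.
have shape_sub (k : 'I_n) : subpartition rows (shape (take k.+1 w)).
  by rewrite prefix_sub ?size_tuple.
apply/is_sytP; split=> [k l eq_kl|k|b b_in|k l eq_row eq_col|k l eq_col eq_row].
- have ltn_kl m : (k < m) = (l < m).
    by rewrite -(ltn_syt_of_word w k) eq_kl ltn_syt_of_word.
  by apply/val_inj/eqP; rewrite eqn_leq -(ltnS k) ltn_kl ltnSn -(ltnS l) -ltn_kl ltnSn.
- rewrite box_inE (leq_trans _ (subpartition_leq _ (shape_sub k))) //.
  by rewrite ltn_syt_of_word.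
- have [|l _] := @syt_of_word_onto w n b (leqnn n); last by exists l.
  by rewrite take_oversize ?size_tuple // shape_lattice_word -?box_inE.
- by rewrite -(ltn_syt_of_word w) -(val_inj eq_row) shape_syt_of_word eq_col.
have k_neq_l : k != l :> nat.
  by apply: contra_eq_neq eq_row => /val_inj ->; rewrite neq_ltn ltnSn.
rewrite ltn_neqAle k_neq_l -ltnS -(ltn_syt_of_word w) -eq_col.
have /andP[shape_noninc _] := shape_sub l.
apply: (@leq_trans (shape (take l.+1 w) (syt_of_word w l).1)).
  by rewrite ltn_syt_of_word.
by rewrite nonincreasing_leq // eq_row.
Qed.

Lemma is_syt_of_word w : is_syt lam (syt_of_word w) = lattice_word rows w.
Proof.
apply/idP/idP; first exact: lattice_word_of_syt.
exact: is_syt_of_lattice_word.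
Qed.

Section TableauWeights.
Local Open Scope ring_scope.

Lemma content_syt_of_word (V : zmodType) (x : int -> V) w (k : 'I_n) :
  x (content (syt_of_word w k).1 (syt_of_word w k).2) =
  skew_weight rows (content_sum n x) (shape (take k w)) -
  skew_weight rows (content_sum n x) (shape (take k.+1 w)).
Proof.
rewrite /skew_weight -sumrB (bigD1 (tnth w k)) //= big1 => [|i /negPf i_w]; last first.
  by rewrite shape_takeS beta_add_box i_w addn0 subrr.
rewrite addr0 shape_takeS beta_add_box eqxx addn1 (content_sumS _ _ (ltn_ord _)).
rewrite -shape_syt_of_word syt_of_word1 /beta.
by rewrite opprB [RHS]addrC addrA subrK.
Qed.

Lemma sum_contents_syt_of_word (V : zmodType) (x : int -> V) w k :
  (k <= n)%N -> lattice_word rows w ->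
  \sum_(m < n | (k <= m)%N) x (content (syt_of_word w m).1 (syt_of_word w m).2) =
  skew_weight rows (content_sum n x) (shape (take k w)).
Proof.
move=> kn w_lattice; under eq_bigr do rewrite content_syt_of_word.
pose weight m := skew_weight rows (content_sum n x) (shape (take m w)).
rewrite -(big_geq_mkord k n xpredT (fun m => weight m - weight m.+1)) /=.
rewrite (telescope_sumr_eq (fun m => - weight m)) // /weight.
  rewrite opprK take_oversize ?size_tuple // shape_lattice_word // addrC.
  by rewrite [X in _ - X]/skew_weight big1 ?subr0 // => i _; rewrite subrr.
by move=> m _; rewrite opprK addrC.
Qed.

Variables (K : fieldType) (x : int -> K).
Local Notation a := (content_sum n x).

Lemma Tx_syt_of_word w : lattice_word rows w ->
  Tx x (syt_of_word w) = word_weight rows a w.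
Proof.
move=> w_lattice; rewrite /Tx /word_weight size_tuple (reindex_inj rev_ord_inj) /=.
apply: eq_bigr => k _; rewrite subnSK // subKn 1?ltnW //.
by rewrite sum_contents_syt_of_word 1?ltnW.
Qed.

Lemma sum_Tx_bialternant :
  (forall mu, subpartition rows mu -> mu != rows -> skew_weight rows a mu != 0) ->
  (\sum_(f : {ffun 'I_n -> 'I_n * 'I_n} | is_syt lam f) Tx x f) *
    bialternant a (beta_values a rows) rows =
  bialternant a (beta_values a rows) [ffun=> 0%N].
Proof.
move=> weight_neq0; have rows_noninc := row_lengths_nonincreasing n lam_part.
have n_sum := esym (sum_row_lengths lam_part lam_size).
rewrite -(sum_word_weight rows_noninc weight_neq0 n_sum); congr (_ * _).
rewrite (reindex_onto syt_of_word word_of_syt) /=; last exact: word_of_sytK.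
apply: eq_big => w; rewrite syt_of_wordK eqxx andbT is_syt_of_word //.
exact: Tx_syt_of_word.
Qed.

End TableauWeights.
End WordTableaux.

Section HookProducts.
Variables (n : nat) (lam : seq nat).
Hypotheses (lam_part : is_partition lam) (lam_size : sumn lam = n).
Local Notation rows := (row_lengths n lam).

Definition beta_gap (c : nat) : nat := c + (n - column_length lam c).

Lemma ltn_beta_gap (i : 'I_n) c : (beta_gap c < beta rows i) = (c < rows i).
Proof.
have := ltn_column_length lam_part c i; have := ltn_ord i.
have := column_length_leq lam_part lam_size c.
by rewrite /beta_gap /beta ffunE; lia.
Qed.

Lemma beta_gap_neq (i : 'I_n) c : beta_gap c != beta rows i.
Proof.
have := ltn_column_length lam_part c i; have := ltn_ord i.
have := column_length_leq lam_part lam_size c.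
by rewrite /beta_gap /beta ffunE; lia.
Qed.

Lemma beta_gap_inj : injective beta_gap.
Proof.
suff lt_gap c d : c < d -> beta_gap c < beta_gap d.
  by move=> c d gap_cd; have := @lt_gap c d; have := @lt_gap d c; lia.
by move=> cd; have := column_length_homo lam_part (ltnW cd); rewrite /beta_gap; lia.
Qed.

Lemma beta_rows_inj : injective (beta rows).
Proof.
have rows_noninc := row_lengths_nonincreasing n lam_part.
move=> i j beta_ij; apply: val_inj.
by case: (ltngtP i j) => // /(ltn_beta rows_noninc); rewrite beta_ij ltnn.
Qed.

Lemma perm_iota_beta (i : 'I_n) :
  perm_eq (iota 0 (beta rows i))
    ([seq beta rows j | j : 'I_n <- enum 'I_n & i < j] ++
     [seq beta_gap c | c <- iota 0 (rows i)]).
Proof.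
rewrite perm_sym; set s := _ ++ _.
have uniq_s : uniq s.
  rewrite cat_uniq (map_inj_uniq beta_rows_inj) (map_inj_uniq beta_gap_inj).
  rewrite filter_uniq ?enum_uniq // iota_uniq andbT; apply/hasPn => _ /mapP[c _ ->].
  by apply/mapP => -[j _ /eqP]; rewrite (negPf (beta_gap_neq _ _)).
have sub_s : {subset s <= iota 0 (beta rows i)}.
  move=> t; rewrite mem_cat mem_iota /= => /orP[] /mapP[].
    move=> j; rewrite mem_filter => /andP[ij _] ->.
    exact: ltn_beta (row_lengths_nonincreasing _ lam_part) ij.
  by move=> c; rewrite mem_iota => /= ci ->; rewrite ltn_beta_gap.
apply: uniq_perm (iota_uniq _ _) _ => //; apply: (uniq_min_size uniq_s sub_s _).2.
rewrite size_iota size_cat !size_map size_iota /beta addnC leq_add2r.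
rewrite size_filter -sum1_count big_enum_cond /=.
rewrite -(big_geq_mkord i.+1 n xpredT (fun=> 1)) /=.
by rewrite sum_nat_const_nat muln1.
Qed.

Local Open Scope ring_scope.

Lemma sum_hook_arm_leg (V : nmodType) (G : 'I_n * 'I_n -> V) (i c : 'I_n) :
  box_in lam (i, c) ->
  \sum_(b in hook n lam i c) G b =
  \sum_(d < n | (c <= d < rows i)%N) G (i, d) +
  \sum_(k < n | (i < k < column_length lam c)%N) G (k, c).
Proof.
rewrite box_inE /= => ci; rewrite (bigID (fun b : 'I_n * 'I_n => b.1 == i)) /=.
congr (_ + _).
  rewrite (reindex_onto (fun d => (i, d)) snd) /=; last first.
    by case=> k d /= /andP[_ /eqP->].
  apply: eq_bigl => d; rewrite inE box_inE /= !eqxx leqnn !andbT /= andbC.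
  have [->|_] := eqVneq (d : nat) c; first by rewrite leqnn.
  by rewrite orbF.
rewrite (reindex_onto (fun k => (k, c)) fst) /=; last first.
  case=> k d /andP[]; rewrite inE /= => /andP[_].
  by case/orP=> /andP[/eqP/val_inj-> _] //; rewrite eqxx.
apply: eq_bigl => k; rewrite inE box_inE /= !eqxx leqnn !andbT /=.
rewrite ltn_column_length // !ffunE -val_eqE /=.
by case: (ltngtP k i); rewrite ?andbF ?andbT.
Qed.

Variables (K : fieldType) (x : int -> K).
Local Notation a := (content_sum n x).

Lemma hook_length_beta (i c : 'I_n) : box_in lam (i, c) ->
  hook_length n lam x i c = a (beta rows i) - a (beta_gap c).
Proof.
move=> ic_box; rewrite /hook_length sum_hook_arm_leg //=.
have c_row : (c < rows i)%N by rewrite box_inE in ic_box.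
have i_col : (i < column_length lam c)%N.
  by rewrite ltn_column_length //; rewrite ffunE in c_row.
have col_n := column_length_leq lam_part lam_size c.
have ord_range (G : nat -> K) p q : (q <= n)%N ->
    \sum_(k < n | (p <= k < q)%N) G k = \sum_(p <= k < q) G k.
  by move=> qn; rewrite big_geq_mkord (big_ord_widen_cond n (fun k => p <= k)%N).
rewrite (ord_range (fun d => x (content i d))) ?row_length_leq //.
rewrite (ord_range (fun k => x (content k c))) //.
rewrite (sum_row_contents _ (ltn_ord i)) ?(ltnW c_row) //.
by rewrite (sum_column_contents _ _ i_col col_n) addrA subrK.
Qed.

Lemma prod_row_hooks (i : 'I_n) :
  \prod_(c < n | box_in lam (i, c)) hook_length n lam x i c =
  \prod_(c <- iota 0 (rows i)) (a (beta rows i) - a (beta_gap c)).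
Proof.
rewrite -[rows i in RHS]subn0 -/(index_iota _ _) big_mkord.
rewrite (big_ord_widen n (fun c => a (beta rows i) - a (beta_gap c)));
  last exact: row_length_leq.
apply: eq_big => c; first by rewrite box_inE.
exact: hook_length_beta.
Qed.

Lemma bialternant_hooks :
  bialternant a (beta_values a rows) rows =
  bialternant a (beta_values a rows) [ffun=> 0%N] *
  \prod_(b : 'I_n * 'I_n | box_in lam b) hook_length n lam x b.1 b.2.
Proof.
rewrite bialternant_diag ?row_lengths_nonincreasing // bialternant0.
rewrite -(pair_big_dep xpredT (fun i c : 'I_n => box_in lam (i, c))
  (fun i c => hook_length n lam x i c)) /= -big_split /=.
apply: eq_bigr => i _; rewrite prod_row_hooks /fact_pow.
rewrite -(big_mkord xpredT (fun t => a (beta rows i) - a t)) /index_iota subn0.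
rewrite (perm_big _ (perm_iota_beta i)) big_cat /= !big_map big_filter big_enum_cond.
by [].
Qed.

Lemma sum_Tx_nondegenerate :
  (forall mu, subpartition rows mu -> mu != rows -> skew_weight rows a mu != 0) ->
  (forall i j : 'I_n, (i < j)%N -> a (beta rows i) != a (beta rows j)) ->
  \sum_(f : {ffun 'I_n -> 'I_n * 'I_n} | is_syt lam f) Tx x f =
  \prod_(b : 'I_n * 'I_n | box_in lam b) (hook_length n lam x b.1 b.2)^-1.
Proof.
move=> weight_neq0 beta_neq; rewrite prodfV.
have := sum_Tx_bialternant lam_part lam_size weight_neq0.
rewrite bialternant_hooks.
set numer0 := bialternant _ _ _; set hooks := \prod_(b | _) _.
have numer0_neq0 : numer0 != 0.
  rewrite /numer0 bialternant0; apply/prodf_neq0 => i _; apply/prodf_neq0 => j ij.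
  by rewrite subr_eq0 beta_neq.
rewrite mulrCA -[RHS]mulr1 => /(mulfI numer0_neq0) sum_hooks.
have hooks_neq0 : hooks != 0.
  by apply: contra_eq_neq sum_hooks => ->; rewrite mulr0 eq_sym oner_neq0.
by apply: (mulIf hooks_neq0); rewrite sum_hooks mulVf.
Qed.

End HookProducts.

Local Notation "p %:F" := (@tofrac _ p) : ring_scope.

Section Deformation.
Local Open Scope ring_scope.
Variables (F : fieldType) (n : nat) (x : int -> F).

(* The exponents are positive on the contents that occur, so that [x] is recovered
   at ['X = 0]. *)
Definition deform (c : int) : {poly F} := (x c)%:P + 'X^(absz (c + n%:Z)).

Local Notation a := (content_sum n deform).

Lemma coef_content_sum_deform k e : (0 < e)%N -> (a k)`_e = (e <= k)%:R.
Proof.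
move=> e_gt0; elim: k => [|k IHk].
  by rewrite /content_sum big_ord0 coef0; case: e e_gt0.
rewrite /content_sum big_ord_recr /= coefD IHk /deform coefD coefC.
rewrite coefXn /content subrK /= eqn0Ngt e_gt0 add0r -natrD.
by congr (_%:R); case: (ltngtP e k.+1) => [|//|->]; lia.
Qed.

Lemma horner_deform (i c : nat) :
  (i < n)%N -> (deform (content i c)).[0] = x (content i c).
Proof.
move=> i_n; rewrite hornerD hornerC hornerXn expr0n.
by rewrite (_ : (_ == 0)%N = false) ?addr0 //; rewrite /content; lia.
Qed.

Variable lam : {ffun 'I_n -> nat}.
Hypothesis lam_noninc : nonincreasing lam.

(* If [i] is the first row where [mu] differs from [lam], the coefficient of
   ['X^(beta lam i)] in the weight is [1]. *)
Lemma skew_weight_deform_neq0 mu :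
  subpartition lam mu -> mu != lam -> skew_weight lam a mu != 0.
Proof.
move=> mu_sub mu_neq; have [i0 i0_neq] : exists i, mu i != lam i.
  apply/existsP; apply: contraR mu_neq => /existsPn mu_eq.
  by apply/eqP/ffunP => i; apply/eqP/negPn.
have [i i_neq i_min] := @arg_minnP _ i0 (fun i => mu i != lam i) val i0_neq.
have mu_lam j : (beta mu j <= beta lam j)%N by rewrite leq_add2r subpartition_leq.
have lt_i : (beta mu i < beta lam i)%N.
  by rewrite ltn_neqAle mu_lam eqn_add2r i_neq.
suff: (skew_weight lam a mu)`_(beta lam i) = 1.
  by apply: contra_eq_neq => ->; rewrite coef0 eq_sym oner_neq0.
have beta_i_gt0 := leq_ltn_trans (leq0n _) lt_i.
rewrite coef_sum (bigD1 i) //= coefB !coef_content_sum_deform // leqnn leqNgt lt_i.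
rewrite subr0 big1 ?addr0 // => j; rewrite coefB neq_ltn => /orP[ji|ij].
  have /eqP mu_j : mu j == lam j by apply: contraTT ji => /i_min; rewrite -leqNgt.
  by rewrite /beta mu_j subrr.
have lt_ij := ltn_beta lam_noninc ij.
rewrite !coef_content_sum_deform // !(leqNgt (beta lam i)) lt_ij.
by rewrite (leq_ltn_trans (mu_lam j)) // subrr.
Qed.

Lemma content_sum_deform_beta_neq (i j : 'I_n) :
  (i < j)%N -> a (beta lam i) != a (beta lam j).
Proof.
move=> /(ltn_beta lam_noninc) lt_ij; have beta_gt0 := leq_ltn_trans (leq0n _) lt_ij.
apply/eqP => /(congr1 (fun p : {poly F} => p`_(beta lam i))).
rewrite !coef_content_sum_deform // leqnn leqNgt lt_ij => /eqP.
by rewrite oner_eq0.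
Qed.

End Deformation.

Lemma sum_Tx_deform (F : fieldType) n lam (x : int -> F) :
  is_partition lam -> sumn lam = n ->
  (\sum_(f : {ffun 'I_n -> 'I_n * 'I_n} | is_syt lam f)
     Tx (fun c => (deform n x c)%:F) f =
   \prod_(b : 'I_n * 'I_n | box_in lam b)
     (hook_length n lam (fun c => (deform n x c)%:F) b.1 b.2)^-1)%R.
Proof.
move=> lam_part lam_size; have rows_noninc := row_lengths_nonincreasing n lam_part.
have content_sumF k := raddf_content_sum (@tofrac {poly F}) n (deform n x) k.
apply: sum_Tx_nondegenerate => // [mu mu_sub mu_neq|i j ij].
  rewrite /skew_weight; under eq_bigr do rewrite !content_sumF -raddfB.
  by rewrite -raddf_sum tofrac_eq0 skew_weight_deform_neq0.
by rewrite !content_sumF tofrac_eq content_sum_deform_beta_neq.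
Qed.

Section Specialization.
Local Open Scope ring_scope.
Variables (R : idomainType) (F : fieldType) (phi : {rmorphism R -> F}).
Implicit Types (u : {fraction R}) (v : F).

(* [v] is the value at [u] of the extension of [phi] to the localization of [R] at the
   kernel of [phi]. *)
Definition specializes u v : Prop :=
  exists p q : R, [/\ phi q != 0, u = p%:F / q%:F & v = phi p / phi q].

Lemma tofrac_neq0 (q : R) : phi q != 0 -> q%:F != 0.
Proof. by rewrite tofrac_eq0; apply: contraNneq => ->; rewrite rmorph0. Qed.

Lemma specializes_uniq u v v' : specializes u v -> specializes u v' -> v = v'.
Proof.
case=> p [q [q_neq0 -> ->]] [p' [q' [q'_neq0 + ->]]].
move/eqP; rewrite eqr_div ?tofrac_neq0 // -!tofracM tofrac_eq => /eqP pq.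
by apply/eqP; rewrite eqr_div // -!rmorphM pq.
Qed.

Lemma specializes_tofrac p : specializes p%:F (phi p).
Proof. by exists p, 1; rewrite tofrac1 rmorph1 !divr1 oner_neq0. Qed.

Lemma specializesD u v u' v' :
  specializes u v -> specializes u' v' -> specializes (u + u') (v + v').
Proof.
case=> p [q [q_neq0 -> ->]] [p' [q' [q'_neq0 -> ->]]].
exists (p * q' + p' * q), (q * q'); split.
- by rewrite rmorphM mulf_neq0.
- by rewrite tofracD !tofracM addf_div ?tofrac_neq0.
by rewrite rmorphD !rmorphM addf_div.
Qed.

Lemma specializesM u v u' v' :
  specializes u v -> specializes u' v' -> specializes (u * u') (v * v').
Proof.
case=> p [q [q_neq0 -> ->]] [p' [q' [q'_neq0 -> ->]]].
exists (p * p'), (q * q'); split.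
- by rewrite rmorphM mulf_neq0.
- by rewrite !tofracM mulf_div.
by rewrite !rmorphM mulf_div.
Qed.

Lemma specializesV u v : v != 0 -> specializes u v -> specializes u^-1 v^-1.
Proof.
move=> v_neq0 [p [q [q_neq0 -> def_v]]].
exists q, p; rewrite def_v !invf_div; split=> //.
by apply: contraNneq v_neq0 => p0; rewrite def_v p0 mul0r.
Qed.

Lemma specializes_sum (I : finType) (P : pred I) (G : I -> {fraction R}) H :
  (forall i, P i -> specializes (G i) (H i)) ->
  specializes (\sum_(i | P i) G i) (\sum_(i | P i) H i).
Proof.
move=> GH; apply: (big_ind2 specializes) => //; last exact: specializesD.
by rewrite -tofrac0 -(rmorph0 phi); apply: specializes_tofrac.
Qed.

Lemma specializes_prod (I : finType) (P : pred I) (G : I -> {fraction R}) H :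
  (forall i, P i -> specializes (G i) (H i)) ->
  specializes (\prod_(i | P i) G i) (\prod_(i | P i) H i).
Proof.
move=> GH; apply: (big_ind2 specializes) => //; last exact: specializesM.
by rewrite -tofrac1 -(rmorph1 phi); apply: specializes_tofrac.
Qed.

End Specialization.

Theorem theorem3p6 (F : fieldType) (n : nat) (lam : seq nat)
  (Hpart : is_partition lam) (Hsize : sumn lam = n) (x : int -> F)
  (Hhook : forall i j, in_diagram lam i j -> hook_length n lam x i j != 0%R)
  (Hden : forall f : {ffun 'I_n -> 'I_n * 'I_n}, is_syt lam f ->
     forall k : 'I_n,
       (\sum_(m : 'I_n | (n - k.+1 <= m)%N) x (content (f m).1 (f m).2))%R != 0%R) :
  (\sum_(f : {ffun 'I_n -> 'I_n * 'I_n} | is_syt lam f) Tx x f)%R =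
  (\prod_(b : 'I_n * 'I_n | box_in lam b) (hook_length n lam x b.1 b.2)^-1)%R.
Proof.
pose at0 : {rmorphism {poly F} -> F} := horner_eval 0%R.
have spec_x (b : 'I_n * 'I_n) :
    specializes at0 ((deform n x (content b.1 b.2))%:F)%R (x (content b.1 b.2)).
  by rewrite -(horner_deform x b.2 (ltn_ord b.1)); apply: specializes_tofrac.
have spec_hooks : specializes at0
    (\prod_(b : 'I_n * 'I_n | box_in lam b)
        (hook_length n lam (fun c => (deform n x c)%:F) b.1 b.2)^-1)%R
    (\prod_(b : 'I_n * 'I_n | box_in lam b) (hook_length n lam x b.1 b.2)^-1)%R.
  apply: specializes_prod => b b_in; apply: specializesV; first exact: Hhook.
  exact: specializes_sum.
apply: specializes_uniq spec_hooks; rewrite -sum_Tx_deform //.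
apply: specializes_sum => f f_syt; apply: specializes_prod => k _.
apply: specializesV; first exact: Hden.
exact: specializes_sum.
Qed.
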